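(* Let $\mathbb{L}$ be a complete, algebraically closed non-Archimedean field of characteristic $0$ and let $\phi$ be a rational map over $\mathbb{L}$, in normalized form, of degree $d\geq 2$ with potential good reduction. Then the fixed point locus $\{\zeta\in\mathbb{P}^1_{an}:\phi(\zeta)=\zeta\}$ of $\phi$ in the Berkovich projective line has at most $d+2$ connected components.
   Context: $\mathbb{P}^1_{an}$ is the Berkovich projective line over $\mathbb{L}$ with the weak topology, on which $\phi$ acts continuously. Normalized form: $\phi=F/G$ with $F,G$ coprime and coefficients in the valuation ring $\mathcal{O}_{\mathbb{L}}$, not all in its maximal ideal $m_{\mathbb{L}}$. Reduction: reduce coefficients mod $m_{\mathbb{L}}$ (cancelling common factors) to get a rational map over $\tilde{\mathbb{L}}=\mathcal{O}_{\mathbb{L}}/m_{\mathbb{L}}$; good reduction means this reduction has degree $\deg\phi$. Potential good reduction means some Möbius conjugate $\sigma\circ\phi\circ\sigma^{-1}$, $\sigma\in PGL_2(\mathbb{L})$, has good reduction. *)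

(* Defs.v *)
From HB Require Import structures.
From mathcomp Require Import all_boot all_order all_algebra.
From mathcomp Require Import reals.
From Stdlib Require List.
Set Implicit Arguments. Unset Strict Implicit. Unset Printing Implicit Defensive.
Import Order.TTheory GRing.Theory Num.Theory.
Local Open Scope ring_scope.

Section Berkovich.
Variables (R : realType) (L : fieldType) (v : L -> R).

Definition nonarch_absval : Prop :=
  [/\ (forall x, 0 <= v x), (forall x, v x = 0 <-> x = 0),
      (forall x y, v (x * y) = v x * v y),
      (forall x y, v (x + y) <= Num.max (v x) (v y)) &
      (exists x, v x != 0 /\ v x != 1)].

Definition complete_absval : Prop :=
  forall u : nat -> L,
    (forall e : R, 0 < e -> exists N, forall m n, (N <= m)%N -> (N <= n)%N ->
        v (u m - u n) < e) ->
    exists l, forall e : R, 0 < e -> exists N, forall n, (N <= n)%N -> v (u n - l) < e.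

(** Points of the Berkovich affine line: multiplicative seminorms on L[T]
    extending v.  A point of P^1_an is [Some s] (s a point of A^1_an) or
    [None] (the point at infinity). *)
Definition mult_seminorm (s : {poly L} -> R) : Prop :=
  [/\ (forall c, s c%:P = v c), (forall p, 0 <= s p),
      (forall p q, s (p * q) = s p * s q) &
      (forall p q, s (p + q) <= s p + s q)].

Definition berk_pt := option ({poly L} -> R).

Definition in_berk (z : berk_pt) : Prop :=
  match z with None => True | Some s => mult_seminorm s end.

Definition evsn (a : L) : {poly L} -> R := fun h => v h.[a].

Definition clpt (x y : L) : berk_pt :=
  if y == 0 then None else Some (evsn (x / y)).

Definition hev (d : nat) (p : {poly L}) (x y : L) : L :=
  \sum_(i < d.+1) p`_i * x ^+ i * y ^+ (d - i).

(** sum_i h_i P^i Q^(m-i) : Q^m h(P/Q) *)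
Definition hcomp (m : nat) (h P Q : {poly L}) : {poly L} :=
  \sum_(i < m.+1) h`_i *: (P ^+ i * Q ^+ (m - i)).

(** The graph of the action of phi = F/G (of degree d) on P^1_an:
    - infinity and classical points go to their classical images;
    - a point s with trivial kernel goes to the seminorm
      h |-> [h o phi]_s = [G^m h(F/G)]_s / [G]_s^m  (m = deg h). *)
Definition berk_act (d : nat) (F G : {poly L}) (z w : berk_pt) : Prop :=
  [\/ z = None /\ w = clpt (hev d F 1 0) (hev d G 1 0),
      exists a, z = Some (evsn a) /\ w = clpt (hev d F a 1) (hev d G a 1) |
      exists s, [/\ z = Some s, (forall h, h != 0 -> s h != 0) &
                    w = Some (fun h : {poly L} => s (hcomp (size h).-1 h F G)
                                       / s G ^+ (size h).-1)]].

Definition berk_fix (d : nat) (F G : {poly L}) : berk_pt -> Prop :=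
  fun z => in_berk z /\ berk_act d F G z z.

(** Weak (Gelfand) topology on A^1_an: basic opens are finite intersections
    of sets { t | lo < t f < hi }. *)
Definition sat_box (l : seq ({poly L} * R * R)) (s : {poly L} -> R) : Prop :=
  forall t, List.In t l -> t.1.2 < s t.1.1 < t.2.

Definition openA (W : ({poly L} -> R) -> Prop) : Prop :=
  forall s, W s -> mult_seminorm s /\
    exists l, sat_box l s /\ forall t, mult_seminorm t -> sat_box l t -> W t.

Definition compactA (K : ({poly L} -> R) -> Prop) : Prop :=
  (forall s, K s -> mult_seminorm s) /\
  forall U : (({poly L} -> R) -> Prop) -> Prop,
    (forall W, U W -> openA W) ->
    (forall s, K s -> exists W, U W /\ W s) ->
    exists l : seq (({poly L} -> R) -> Prop),
      (forall W, List.In W l -> U W) /\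
      (forall s, K s -> exists W, List.In W l /\ W s).

(** Topology on P^1_an = one-point compactification of A^1_an. *)
Definition openP (W : berk_pt -> Prop) : Prop :=
  [/\ (forall z, W z -> in_berk z),
      openA (fun s => W (Some s)) &
      (W None -> compactA (fun s => mult_seminorm s /\ ~ W (Some s)))].

Definition connectedP (C : berk_pt -> Prop) : Prop :=
  forall U V, openP U -> openP V ->
    (forall z, C z -> U z \/ V z) ->
    (forall z, C z -> U z -> V z -> False) ->
    (exists z, C z /\ U z) -> (exists z, C z /\ V z) -> False.

Definition same_component (A : berk_pt -> Prop) (x y : berk_pt) : Prop :=
  exists C, (forall z, C z -> A z) /\ connectedP C /\ C x /\ C y.

Definition normalized_form (d : nat) (F G : {poly L}) : Prop :=
  [/\ (forall i, v F`_i <= 1), (forall i, v G`_i <= 1),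
      (exists i, v F`_i = 1 \/ v G`_i = 1),
      coprimep F G & maxn (size F) (size G) = d.+1].

(** The pair (P, Q) of degree-d forms (P(X,Y) = sum_{i<=d} P_i X^i Y^(d-i))
    has good reduction: after scaling into normalized form (coefficients in
    O_L, not all in m_L), the reduced forms have no common zero in
    P^1(residue field), i.e. the reduced map still has degree d. *)
Definition good_reduction_forms (d : nat) (P Q : {poly L}) : Prop :=
  exists lam : L,
  [/\ lam != 0,
      (forall i, v (lam * P`_i) <= 1), (forall i, v (lam * Q`_i) <= 1),
      (exists i, v (lam * P`_i) = 1 \/ v (lam * Q`_i) = 1) &
      forall x y, Num.max (v x) (v y) = 1 ->
        ~ (v (lam * hev d P x y) < 1 /\ v (lam * hev d Q x y) < 1)].

(** sigma o phi o sigma^{-1} for sigma = (a z + b)/(c z + e), as a pair of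
    degree-d forms (using the adjugate for sigma^{-1}). *)
Definition conj_forms (d : nat) (F G : {poly L}) (a b c e : L)
  : {poly L} * {poly L} :=
  let U := e *: 'X - b%:P in
  let W := (- c) *: 'X + a%:P in
  let F' := hcomp d F U W in
  let G' := hcomp d G U W in
  (a *: F' + b *: G', c *: F' + e *: G').

Definition potential_good_reduction (d : nat) (F G : {poly L}) : Prop :=
  exists a b c e : L, a * e - b * c != 0 /\
    good_reduction_forms d (conj_forms d F G a b c e).1
                           (conj_forms d F G a b c e).2.

End Berkovich.

(* Main.v *)
(** Potential good reduction gives a coordinate [y] and a representative [p / q]
    of the map with good reduction.  A point of the Berkovich line off the
    classical points is represented by an element of a valued extension field of
    [L], transcendental over [L], and is determined by the values [n (y - a)],
    [a] in [L].  After replacing [y] by [1 / y] if necessary, [n y <= 1], and the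
    path from the point to the Gauss point is given by the elements [y + U] with
    [U] of Gauss norm [r], where [r] runs from
    [delta = inf n (y - a)] (positive, by completeness) to [1].  If the point is
    fixed, so is the whole path: [p / q] does not expand distances on the residue
    disk of [y]; and if [b] is close to [y], then [p / q - (p / q)(b)] has size at
    least [delta] at [y] and vanishes at [b], so its size on the disk of radius
    [r] is at least [delta * r / n (y - b)], which tends to [r] as
    [n (y - b)] tends to [delta].  Thus all nonclassical fixed points lie in one
    component, and there are at most [d + 1] classical ones. *)
From HB Require Import structures.
From mathcomp Require Import all_boot all_order all_algebra.
From mathcomp Require Import ring lra.
From mathcomp Require Import boolp classical_sets reals topology normedtype.
Require Import Defs.
Import Order.TTheory GRing.Theory Num.Theory.
Import numFieldNormedType.Exports.
Local Open Scope ring_scope.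
Set Implicit Arguments.
Unset Strict Implicit.
Unset Printing Implicit Defensive.

(** * Non-Archimedean absolute values *)

Definition ultra_abs (R : realType) (A : idomainType) (n : A -> R) : Prop :=
  [/\ (forall x, 0 <= n x), (forall x, n x = 0 <-> x = 0),
      (forall x y, n (x * y) = n x * n y) &
      (forall x y, n (x + y) <= Num.max (n x) (n y))].

Section UltraAbs.
Variables (R : realType) (A : idomainType) (n : A -> R).
Hypothesis nP : ultra_abs n.

Lemma uabs_ge0 x : 0 <= n x. Proof. by case: nP. Qed.
Lemma uabsM x y : n (x * y) = n x * n y. Proof. by case: nP. Qed.
Lemma uabsD x y : n (x + y) <= Num.max (n x) (n y). Proof. by case: nP. Qed.
Lemma uabs0 : n 0 = 0. Proof. by case: nP => _ h _ _; apply/h. Qed.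

Lemma uabs_eq0 x : (n x == 0) = (x == 0).
Proof. by case: nP => _ h _ _; apply/eqP/eqP => /h. Qed.

Lemma uabs_gt0 x : (0 < n x) = (x != 0).
Proof. by rewrite lt_def uabs_ge0 andbT uabs_eq0. Qed.

Lemma uabs1 : n 1 = 1.
Proof.
have n1 : n 1 != 0 by rewrite uabs_eq0 oner_eq0.
by apply: (mulIf n1); rewrite -uabsM !mul1r.
Qed.

Lemma uabsX x k : n (x ^+ k) = n x ^+ k.
Proof. by elim: k => [|k IH]; rewrite ?expr0 ?uabs1 // !exprS uabsM IH. Qed.

Lemma uabsN x : n (- x) = n x.
Proof.
have : n (-1) ^+ 2 = 1 by rewrite -uabsX sqrrN expr1n uabs1.
move/eqP; rewrite sqrp_eq1 ?uabs_ge0 // => /eqP h.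
by rewrite -mulN1r uabsM h mul1r.
Qed.

Lemma uabsB x y : n (x - y) <= Num.max (n x) (n y).
Proof. by rewrite -[n y]uabsN uabsD. Qed.

Lemma uabsBC x y : n (x - y) = n (y - x).
Proof. by rewrite -uabsN opprB. Qed.

Lemma uabsB_trans y x z : n (x - z) <= Num.max (n (x - y)) (n (y - z)).
Proof. by have := uabsD (x - y) (y - z); rewrite addrA subrK. Qed.

Lemma uabsB_eq x y : n (x - y) < n x -> n y = n x.
Proof.
move=> h; have h1 : n y <= n x.
  have := uabsB x (x - y); rewrite subKr => /le_trans; apply.
  by rewrite ge_max lexx ltW.
apply/eqP; rewrite eq_le h1 /= leNgt; apply/negP => h2.
have := uabsD (x - y) y; rewrite subrK.
by rewrite leNgt gt_max h h2.
Qed.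

Lemma uabs_sum_lt (I : finType) (P : pred I) (f : I -> A) M :
  0 < M -> (forall i, P i -> n (f i) < M) -> n (\sum_(i | P i) f i) < M.
Proof.
move=> M0 h; elim/big_ind: _ => [|x y hx hy|//]; first by rewrite uabs0.
by apply: (le_lt_trans (uabsD x y)); rewrite gt_max hx hy.
Qed.

Lemma uabs_sum_le (I : finType) (P : pred I) (f : I -> A) M :
  0 <= M -> (forall i, P i -> n (f i) <= M) -> n (\sum_(i | P i) f i) <= M.
Proof.
move=> M0 h; elim/big_ind: _ => [|x y hx hy|//]; first by rewrite uabs0.
by apply: (le_trans (uabsD x y)); rewrite ge_max hx hy.
Qed.

Lemma uabs_prod (I : Type) (s : seq I) (f : I -> A) :
  n (\prod_(i <- s) f i) = \prod_(i <- s) n (f i).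
Proof. by elim/big_rec2: _ => [|i x y _ <-]; rewrite ?uabs1 ?uabsM. Qed.

(** * Gauss norms on polynomials *)

Definition gauss (r : R) (p : {poly A}) : R :=
  \big[Num.max/0]_(i < size p) (n p`_i * r ^+ i).

Section Gauss.
Variable r : R.
Hypothesis r0 : 0 < r.

Lemma gauss_term_ge0 (p : {poly A}) i : 0 <= n p`_i * r ^+ i.
Proof. by rewrite mulr_ge0 ?uabs_ge0 // exprn_ge0 // ltW. Qed.

Lemma gauss_term_le (p : {poly A}) i : n p`_i * r ^+ i <= gauss r p.
Proof.
have [ip|pi] := ltnP i (size p).
  exact: (@le_bigmax _ _ _ 0 (fun j : 'I_(size p) => n p`_j * r ^+ j) (Ordinal ip)).
by rewrite nth_default // uabs0 mul0r; apply: bigmax_ge_id.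
Qed.

Lemma gauss_attained (p : {poly A}) : exists i, gauss r p = n p`_i * r ^+ i.
Proof.
rewrite /gauss; elim/big_ind: _ => [|x y [i ->] [j ->]|i _]; last by exists i.
  by exists (size p); rewrite nth_default // uabs0 mul0r.
by rewrite /Num.max; case: ifP => _; [exists j | exists i].
Qed.

Lemma gauss_ge0 (p : {poly A}) : 0 <= gauss r p.
Proof. by have [i ->] := gauss_attained p; apply: gauss_term_ge0. Qed.

Lemma gauss_eq0 (p : {poly A}) : gauss r p = 0 <-> p = 0.
Proof.
split=> [h|->]; last by rewrite /gauss size_poly0 big_ord0.
apply/polyP => i; rewrite coef0; apply/eqP; rewrite -uabs_eq0.
have := gauss_term_le p i; rewrite h => h1.
have := exprn_gt0 i r0; rewrite eq_le uabs_ge0 andbT => ri.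
by rewrite -(pmulr_lle0 _ ri).
Qed.

(** Choosing the least index that attains the maximum makes every earlier term strictly smaller;
    this strictness is what prevents cancellation in the product of two polynomials. *)
Lemma gauss_leading_term (p : {poly A}) : p != 0 ->
  exists2 i, n p`_i * r ^+ i = gauss r p &
    forall j, (j < i)%N -> n p`_j * r ^+ j < gauss r p.
Proof.
move=> p0; have [i hi] := gauss_attained p.
have ex : exists i, n p`_i * r ^+ i == gauss r p by exists i; rewrite hi.
case: (ex_minnP ex) => m /eqP hm mmin; exists m => // j jm.
rewrite lt_neqAle gauss_term_le andbT; apply/negP => /mmin.
by rewrite leqNgt jm.
Qed.

(* The product of the first maximal terms of [p] and [q] strictly dominates the
   other contributions to the same coefficient of [p * q]. *)
Lemma gaussM (p q : {poly A}) : gauss r (p * q) = gauss r p * gauss r q.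
Proof.
have [->|p0] := eqVneq p 0; first by rewrite mul0r (gauss_eq0 0).2 ?mul0r.
have [->|q0] := eqVneq q 0; first by rewrite mulr0 (gauss_eq0 0).2 ?mulr0.
have gp : 0 < gauss r p.
  by rewrite lt_def gauss_ge0 andbT; apply: contraNneq p0 => /gauss_eq0 ->.
have gq : 0 < gauss r q.
  by rewrite lt_def gauss_ge0 andbT; apply: contraNneq q0 => /gauss_eq0 ->.
apply: le_anti; apply/andP; split.
  have [k ->] := gauss_attained (p * q).
  have rk := exprn_gt0 k r0.
  rewrite -ler_pdivlMr // coefM; apply: uabs_sum_le => [|i _].
    by rewrite divr_ge0 ?mulr_ge0 ?ltW.
  rewrite ler_pdivlMr //.
  have -> : r ^+ k = r ^+ i * r ^+ (k - i) by rewrite -exprD subnKC // -ltnS.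
  rewrite uabsM mulrACA.
  by apply: ler_pM; rewrite ?gauss_term_ge0 ?gauss_term_le.
have [i hi imin] := gauss_leading_term p0.
have [j hj jmin] := gauss_leading_term q0.
apply: le_trans (gauss_term_le _ (i + j)).
have rk := exprn_gt0 (i + j) r0.
rewrite leNgt -ltr_pdivlMr //; set M := _ / _; apply/negP => h.
have M0 : 0 < M by rewrite divr_gt0 ?mulr_gt0.
have ij : (i < (i + j).+1)%N by rewrite ltnS leq_addr.
move: h; rewrite coefM (bigD1 (Ordinal ij)) //= addKn; set S := \sum_(_ | _) _ => h.
have hS : n S < M.
  apply: uabs_sum_lt => // k ki; rewrite ltr_pdivlMr //.
  have -> : r ^+ (i + j) = r ^+ k * r ^+ (i + j - k).
    by rewrite -exprD subnKC // -ltnS.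
  rewrite uabsM mulrACA; move: ki; rewrite -val_eqE /= neq_ltn => /orP[ki|ik].
    apply: le_lt_trans (ler_wpM2l (gauss_term_ge0 p k) (gauss_term_le q _)) _.
    by rewrite ltr_pM2r // imin.
  apply: le_lt_trans (ler_wpM2r (gauss_term_ge0 q _) (gauss_term_le p _)) _.
  rewrite ltr_pM2l // jmin // ltn_subLR ?ltn_add2r // -ltnS; exact: ltn_ord.
have : n (p`_i * q`_j) < M.
  rewrite -[p`_i * _](addrK S); apply: (le_lt_trans (uabsB _ _)).
  by rewrite gt_max h hS.
by rewrite uabsM ltr_pdivlMr // exprD mulrACA hi hj ltxx.
Qed.


Lemma gauss_uabs : ultra_abs (gauss r).
Proof.
split; [exact: gauss_ge0 | exact: gauss_eq0 | exact: gaussM |] => p q.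
have [i ->] := gauss_attained (p + q); rewrite coefD.
have ri : 0 <= r ^+ i by rewrite exprn_ge0 // ltW.
apply: (le_trans (ler_wpM2r ri (uabsD _ _))).
by rewrite maxr_pMl // ge_max !le_max !gauss_term_le orbT.
Qed.

Lemma gauss_XaddC c : gauss r ('X + c%:P) = Num.max (n c) r.
Proof.
rewrite /gauss size_XaddC !big_ord_recl big_ord0 /= !coefD !coefX !coefC /=.
rewrite addr0 add0r uabs1 mul1r mulr1 expr1 (max_l (ltW r0)) //.
Qed.

Lemma gaussC c : gauss r c%:P = n c.
Proof.
apply: le_anti; apply/andP; split.
  have [[|i] ->] := gauss_attained c%:P; rewrite coefC /= ?mulr1 //.
  by rewrite uabs0 mul0r uabs_ge0.
by have := gauss_term_le c%:P 0; rewrite coefC /= mulr1.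
Qed.

End Gauss.


(** * Extension of an absolute value to the fraction field *)

Definition frac_abs (x : {fraction A}) : R :=
  n (repr x : {ratio A}).1 / n (repr x : {ratio A}).2.

Lemma fraction_numden (x : {fraction A}) :
  x = tofrac (repr x : {ratio A}).1 / tofrac (repr x : {ratio A}).2.
Proof.
have d0 := denom_ratioP (repr x).
unlock tofrac; rewrite -[_^-1]FracField.pi_inv -[RHS]FracField.pi_mul.
rewrite /FracField.mulf /FracField.invf !numden_Ratio ?oner_eq0 // mul1r mulr1.
by rewrite Ratio_numden reprK.
Qed.

(** The representative picked by [repr] does not matter: equal fractions have equal cross products,
    and [n] is multiplicative. *)
Lemma frac_absE (a b : A) : b != 0 -> frac_abs (tofrac a / tofrac b) = n a / n b.
Proof.
move=> b0; rewrite /frac_abs.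
have := fraction_numden (tofrac a / tofrac b); move: (repr _) => u.
have u0 := denom_ratioP u.
move/eqP; rewrite eqr_div ?tofrac_eq0 // -!tofracM tofrac_eq => /eqP.
move/(congr1 n); rewrite !uabsM => h.
by apply/eqP; rewrite eqr_div ?uabs_eq0 // h.
Qed.

Lemma frac_uabs : ultra_abs frac_abs.
Proof.
have d0 x := denom_ratioP (repr (x : {fraction A})).
split=> [x|x|x y|x y].
- by rewrite divr_ge0 ?uabs_ge0.
- rewrite {2}[x]fraction_numden; split=> /eqP; rewrite mulf_eq0 invr_eq0.
    by rewrite !uabs_eq0 (negPf (d0 x)) orbF => /eqP ->; rewrite tofrac0 mul0r.
  rewrite !tofrac_eq0 (negPf (d0 x)) orbF => /eqP h.
  by rewrite /frac_abs h uabs0 mul0r.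
- rewrite {1}[x]fraction_numden {1}[y]fraction_numden mulf_div -!tofracM.
  by rewrite frac_absE ?mulf_neq0 // !uabsM mulf_div.
rewrite {1}[x]fraction_numden {1}[y]fraction_numden.
rewrite addf_div ?tofrac_eq0 // -!tofracM -tofracD frac_absE ?mulf_neq0 //.
rewrite uabsM ler_pdivrMr ?mulr_gt0 ?uabs_gt0 //.
apply: (le_trans (uabsD _ _)); rewrite /frac_abs.
have := d0 x; have := d0 y; rewrite -!uabs_eq0 => y0 x0.
rewrite maxr_pMl ?mulr_ge0 ?uabs_ge0 // !uabsM.
set a := n _.1 / _ * _; set b := n _.1 / _ * _.
have -> : a = n (repr x : {ratio A}).1 * n (repr y : {ratio A}).2.
  by rewrite /a mulrA divfK.
have -> : b = n (repr y : {ratio A}).1 * n (repr x : {ratio A}).2.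
  by rewrite /b mulrCA divfK // mulrC.
by [].
Qed.

Lemma frac_absF a : frac_abs (tofrac a) = n a.
Proof. by rewrite -[tofrac a]divr1 -tofrac1 frac_absE ?oner_eq0 // uabs1 divr1. Qed.

End UltraAbs.

Lemma uabsV (R : realType) (K : fieldType) (n : K -> R) x :
  ultra_abs n -> n x^-1 = (n x)^-1.
Proof.
move=> nP; have [->|x0] := eqVneq x 0; first by rewrite !(invr0, uabs0 nP).
have nx0 : n x != 0 by rewrite (uabs_eq0 nP).
by apply: (mulIf nx0); rewrite -(uabsM nP) !mulVf // (uabs1 nP).
Qed.

(** * Points of the Berkovich line in valued extension fields *)

Definition ev (L K : fieldType) (io : {rmorphism L -> K}) (h : {poly L}) (x : K) :=
  (map_poly io h).[x].

Section Eval.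
Variables (L K : fieldType) (io : {rmorphism L -> K}).
Implicit Types (h p q : {poly L}) (x : K).

Lemma evD p q x : ev io (p + q) x = ev io p x + ev io q x.
Proof. by rewrite /ev rmorphD hornerD. Qed.

Lemma evM p q x : ev io (p * q) x = ev io p x * ev io q x.
Proof. by rewrite /ev rmorphM hornerM. Qed.

Lemma evB p q x : ev io (p - q) x = ev io p x - ev io q x.
Proof. by rewrite /ev rmorphB hornerD hornerN. Qed.

Lemma evC c x : ev io c%:P x = io c.
Proof. by rewrite /ev map_polyC hornerC. Qed.

Lemma evZ c p x : ev io (c *: p) x = io c * ev io p x.
Proof. by rewrite -mul_polyC evM evC. Qed.

Lemma evX x : ev io 'X x = x.
Proof. by rewrite /ev map_polyX hornerX. Qed.

Lemma evXn p k x : ev io (p ^+ k) x = ev io p x ^+ k.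
Proof. by rewrite /ev rmorphXn horner_exp. Qed.

Lemma ev_sum (I : Type) (s : seq I) (f : I -> {poly L}) x :
  ev io (\sum_(i <- s) f i) x = \sum_(i <- s) ev io (f i) x.
Proof.
by elim/big_rec2: _ => [|i y p _ <-]; rewrite ?evD // -polyC0 evC rmorph0.
Qed.

Lemma ev_prod (I : Type) (s : seq I) (f : I -> {poly L}) x :
  ev io (\prod_(i <- s) f i) x = \prod_(i <- s) ev io (f i) x.
Proof.
by elim/big_rec2: _ => [|i y p _ <-]; rewrite ?evM // -polyC1 evC rmorph1.
Qed.

Lemma ev_io h a : ev io h (io a) = io h.[a].
Proof. exact: horner_map. Qed.

Lemma ev_coef m h x : (size h <= m)%N ->
  ev io h x = \sum_(i < m) io h`_i * x ^+ i.
Proof.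
move=> hm; rewrite /ev (@horner_coef_wide _ m) ?size_map_poly //.
by apply: eq_bigr => i _; rewrite coef_map.
Qed.

Lemma hcomp_ev m h P Q x : (size h <= m.+1)%N -> ev io Q x != 0 ->
  ev io (hcomp m h P Q) x = ev io Q x ^+ m * ev io h (ev io P x / ev io Q x).
Proof.
move=> hm Q0; rewrite (ev_coef _ hm) mulr_sumr ev_sum; apply: eq_bigr => i _.
rewrite evZ evM !evXn expr_div_n [RHS]mulrCA; congr (_ * _).
rewrite [RHS]mulrCA; congr (_ * _).
have -> : ev io Q x ^+ m = ev io Q x ^+ (m - i) * ev io Q x ^+ i.
  by rewrite -exprD subnK // -ltnS.
by rewrite mulfK // expf_neq0.
Qed.

End Eval.

Section Points.
Variables (R : realType) (L : closedFieldType) (v : L -> R).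
Hypothesis vP : ultra_abs v.

Definition roots_of (h : {poly L}) : seq L := sval (closed_field_poly_normal h).

Lemma roots_ofE h : h = lead_coef h *: \prod_(a <- roots_of h) ('X - a%:P).
Proof. by rewrite {1}(svalP (closed_field_poly_normal h)). Qed.

(** Since [L] is algebraically closed, a multiplicative seminorm is determined by its values [l a]
    on the polynomials [T - a]. Equality of points and continuity of paths are thereby checked on
    linear polynomials only. *)
Definition lin_ext (l : L -> R) (h : {poly L}) : R :=
  v (lead_coef h) * \prod_(a <- roots_of h) l a.

Definition vext (K : fieldType) (io : {rmorphism L -> K}) (n : K -> R) : Prop :=
  ultra_abs n /\ forall c, n (io c) = v c.

Definition pt (K : fieldType) (io : {rmorphism L -> K}) (n : K -> R) (x : K) :
  {poly L} -> R := fun h => n (ev io h x).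

Section Point.
Variables (K : fieldType) (io : {rmorphism L -> K}) (n : K -> R).
Hypothesis nP : vext io n.
Implicit Types (x y : K).

Let uP : ultra_abs n. Proof. by case: nP. Qed.

Lemma vext_io c : n (io c) = v c. Proof. by case: nP. Qed.

Lemma pt_lin_ext x : pt io n x = lin_ext (fun a => n (x - io a)).
Proof.
apply: funext => h; rewrite /pt {1}[h]roots_ofE evZ ev_prod (uabsM uP).
rewrite vext_io (uabs_prod uP); congr (_ * _); apply: eq_bigr => a _.
by rewrite evB evX evC.
Qed.

Lemma pt_seminorm x : mult_seminorm v (pt io n x).
Proof.
split=> [c|p|p q|p q]; rewrite /pt.
- by rewrite evC vext_io.
- exact: uabs_ge0.
- by rewrite evM uabsM.
rewrite evD (le_trans (uabsD uP _ _)) // ge_max lerDl lerDr.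
by rewrite !(uabs_ge0 uP).
Qed.

Lemma ev_neq0 x (h : {poly L}) : (forall a, x != io a) -> h != 0 -> ev io h x != 0.
Proof.
move=> xL h0; rewrite [h]roots_ofE evZ ev_prod mulf_neq0 //.
  by rewrite fmorph_eq0 lead_coef_eq0.
rewrite prodf_seq_neq0; apply/allP => a _ /=; rewrite evB evX evC subr_eq0.
exact: xL.
Qed.

(** The element is [z = X + y] in [K(X)] with the Gauss norm of radius [r]: then
    [z - a = X + (y - a)] has size [max (n (y - a)) r]. It represents the disk of radius [r] around
    [y]. *)
Lemma gauss_point y r : 0 < r ->
  exists (E : fieldType) (jo : {rmorphism L -> E}) (m : E -> R) (z : E),
    vext jo m /\ forall a, m (z - jo a) = Num.max (n (y - io a)) r.
Proof.
move=> r0; pose E : fieldType := {fraction {poly K}}.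
pose jo : {rmorphism L -> E} := (@tofrac {poly K} \o (@polyC K \o io)).
have gP := gauss_uabs uP r0; have fP := frac_uabs gP.
exists E, jo, (frac_abs (gauss n r)), (tofrac ('X + y%:P)).
split=> [|a]; first split=> // c.
  by rewrite frac_absF // gaussC // vext_io.
rewrite -tofracB frac_absF //= -addrA -polyCN -polyCD.
by rewrite gauss_XaddC.
Qed.

End Point.

Lemma pt_eq (K E : fieldType) (io : {rmorphism L -> K}) (jo : {rmorphism L -> E})
    n m x y : vext io n -> vext jo m ->
  (forall a, n (x - io a) = m (y - jo a)) -> pt io n x = pt jo m y.
Proof.
by move=> nP mP e; rewrite !pt_lin_ext //; congr lin_ext; apply: funext.
Qed.

(** * Multiplicative seminorms are ultrametric *)

Lemma vnat k : v k%:R <= 1.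
Proof.
elim: k => [|k IH]; first by rewrite (uabs0 vP).
by rewrite mulrS (le_trans (uabsD vP _ _)) // ge_max (uabs1 vP) lexx.
Qed.

Lemma bernoulli (e : R) k : 0 <= e -> 1 + e *+ k <= (1 + e) ^+ k.
Proof.
move=> e0; elim: k => [|k IH]; first by rewrite mulr0n addr0 expr0.
rewrite exprS; apply: le_trans (ler_wpM2l _ IH); last by rewrite addr_ge0.
rewrite mulrS; have : 0 <= e * (e *+ k) by rewrite mulr_ge0 // mulrn_wge0.
by move: (e *+ k) => y; nra.
Qed.

(** If [M < t], the powers of [t / M = 1 + e] would grow at most linearly, whereas squaring
    Bernoulli's inequality gives quadratic growth. *)
Lemma pow_le_linear (t M : R) : 0 <= M ->
  (forall k, t ^+ k <= M ^+ k *+ k.+1) -> t <= M.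
Proof.
move=> M0 h; rewrite leNgt; apply/negP => Mt.
have [M00|Mn0] := eqVneq M 0.
  have := h 1%N; by rewrite M00 !expr1 mul0rn leNgt -M00 Mt.
have Mp : 0 < M by rewrite lt_def Mn0.
pose e := t / M - 1.
have e0 : 0 < e by rewrite subr_gt0 ltr_pdivlMr // mul1r.
have he k : (1 + e) ^+ k <= k.+1%:R.
  rewrite /e addrC subrK expr_div_n ler_pdivrMr ?exprn_gt0 //.
  by rewrite mulr_natl.
(* With [K = k + 1] one gets [(1 + e K)^2 <= (1 + e)^(2 K) <= 2 K + 1], while [e^2 K > 2] makes the
   left side exceed [1 + 2 K]. *)
pose k := Num.truncn (2 / e ^+ 2).
have hk : 2 / e ^+ 2 < k.+1%:R by apply: truncnS_gt.
have h2 := he (k.+1 * 2)%N; have b := bernoulli k.+1 (ltW e0).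
have : (1 + e *+ k.+1) ^+ 2 <= (k.+1 * 2).+1%:R.
  apply: le_trans h2; rewrite exprM lerXn2r // nnegrE ?exprn_ge0 //.
    by rewrite addr_ge0 // mulrn_wge0 // ltW.
  by rewrite addr_ge0 // ltW.
rewrite -mulr_natr -[(_ * 2).+1]addn1 natrD natrM.
move: hk; rewrite ltr_pdivrMr ?exprn_gt0 //.
set K := k.+1%:R => hk; have K0 : 0 < K by rewrite ltr0n.
nra.
Qed.

(** Binomial coefficients have size at most 1, so expanding the [k]-th power of [p + q] bounds it by
    [k + 1] times the [k]-th power of the maximum; [pow_le_linear] removes the linear factor. *)
Lemma seminorm_ultra s : mult_seminorm v s ->
  forall p q, s (p + q) <= Num.max (s p) (s q).
Proof.
case=> sC s0 sM sD p q; set M := Num.max _ _.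
have M0 : 0 <= M by rewrite le_max s0.
have sX f k : s (f ^+ k) = s f ^+ k.
  elim: k => [|k IH]; first by rewrite !expr0 -polyC1 sC (uabs1 vP).
  by rewrite !exprS sM IH.
have sMn f k : s (f *+ k) <= s f.
  by rewrite -mulr_natl -polyC_natr sM sC ler_piMl // vnat.
have ssum (I : finType) (f : I -> {poly L}) :
    s (\sum_i f i) <= \sum_i s (f i).
  elim/big_ind2: _ => // [|a b c e h1 h2].
    by rewrite -polyC0 sC (uabs0 vP).
  exact: le_trans (sD _ _) (lerD h1 h2).
apply: pow_le_linear => // k; rewrite -sX exprDn (le_trans (ssum _ _)) //.
rewrite -[k.+1 in leRHS]card_ord -sumr_const; apply: ler_sum => i _.
rewrite (le_trans (sMn _ _)) // sM !sX.
have -> : M ^+ k = M ^+ (k - i) * M ^+ i by rewrite -exprD subnK // -ltnS.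
by rewrite ler_pM ?exprn_ge0 // lerXn2r ?nnegrE // le_max lexx ?orbT.
Qed.

(** Trivial kernel makes [s] an absolute value on [L[T]], which extends to [L(T)]; the point is then
    evaluation at [T] itself. *)
Lemma norm_point s : mult_seminorm v s -> (forall h, h != 0 -> s h != 0) ->
  exists (K : fieldType) (io : {rmorphism L -> K}) (n : K -> R) (x : K),
    [/\ vext io n, forall a, x != io a & s = pt io n x].
Proof.
move=> sP sn0; have [sC s0 sM _] := sP.
have nP : ultra_abs s.
  split=> // [h|]; last exact: seminorm_ultra.
  split=> [h0|->]; last by rewrite -polyC0 sC (uabs0 vP).
  by apply/eqP; apply: contraTT isT => /sn0; rewrite h0 eqxx.
pose K : fieldType := {fraction {poly L}}.
pose io : {rmorphism L -> K} := (@tofrac {poly L} \o @polyC L).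
exists K, io, (frac_abs s), (tofrac 'X); split.
- split=> [|c]; first exact: frac_uabs.
  by rewrite /= frac_absF.
- by move=> a; rewrite tofrac_eq -subr_eq0 polyXsubC_eq0.
apply: funext => h; rewrite /pt /ev.
have -> : map_poly io h = map_poly (@tofrac {poly L}) (map_poly polyC h).
  by rewrite -map_poly_comp.
by rewrite horner_map frac_absF // -[_.['X]]/(h \Po 'X) comp_polyXr.
Qed.

Section Fix.
Variables (d : nat) (F G : {poly L}).
Hypothesis G0 : G != 0.
Variables (K : fieldType) (io : {rmorphism L -> K}) (n : K -> R) (x : K).
Hypothesis (nP : vext io n) (xL : forall a, x != io a).
Let w := ev io F x / ev io G x.

(** The power of [G] at [x] produced by clearing denominators cancels, so on such points the action
    is the substitution of [F(x) / G(x)] for [x] in [K]. *)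
Lemma pt_image (h : {poly L}) :
  pt io n x (hcomp (size h).-1 h F G) / pt io n x G ^+ (size h).-1 = pt io n w h.
Proof.
have uP : ultra_abs n by case: nP.
have Gx : ev io G x != 0 by apply: ev_neq0.
rewrite /pt hcomp_ev ?leqSpred // (uabsM uP) (uabsX uP) mulrAC divff ?mul1r //.
by rewrite expf_neq0 // (uabs_eq0 uP).
Qed.

Lemma pt_fixP : berk_fix v d F G (Some (pt io n x)) <->
  forall a, n (w - io a) = n (x - io a).
Proof.
have uP : ultra_abs n by case: nP.
split=> [[_]|h].
  (* The classical clause of the action is impossible: testing on [T - b] would give [x = b], an
     element of [L]. *)
  case=> [[] //|[b [[/(congr1 (fun f => f ('X - b%:P))) e _]]]|].
    move=> a; move: e; rewrite /pt /evsn evB evX evC !hornerE subrr (uabs0 vP).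
    by move/eqP; rewrite (uabs_eq0 uP) subr_eq0 (negPf (xL b)).
  move=> [s [[<-] _ [e]]] a; have := congr1 (fun f => f ('X - a%:P)) e.
  by rewrite pt_image /pt !evB !evX !evC => ->.
split; first exact: pt_seminorm.
apply: Or33; exists (pt io n x); split=> // [p p0|].
  by rewrite (uabs_eq0 uP) ev_neq0.
congr Some; apply: funext => p; rewrite pt_image.
by rewrite (@pt_eq _ _ io io n n x w).
Qed.

End Fix.
End Points.

(** * Fixed disks of a map with good reduction *)

Section Core.
Variables (R : realType) (L : closedFieldType) (v : L -> R).
Hypothesis vP : ultra_abs v.

Definition coefs_le1 (p : {poly L}) := forall i, v p`_i <= 1.

Section Integral.
Variables (K : fieldType) (io : {rmorphism L -> K}) (n : K -> R).
Hypothesis nP : vext v io n.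
Variable p : {poly L}.
Hypothesis pint : coefs_le1 p.

Let uP : ultra_abs n. Proof. by case: nP. Qed.

Lemma integral_ev_le1 x : n x <= 1 -> n (ev io p x) <= 1.
Proof.
move=> x1; rewrite (ev_coef _ _ (leqnn _)); apply: (uabs_sum_le uP) => // i _.
rewrite (uabsM uP) (uabsX uP) (vext_io nP).
by rewrite mulr_ile1 ?exprn_ile1 ?exprn_ge0 ?(uabs_ge0 uP) ?(uabs_ge0 vP).
Qed.

Lemma integral_ev_lip x y : n x <= 1 -> n y <= 1 ->
  n (ev io p x - ev io p y) <= n (x - y).
Proof.
move=> x1 y1; rewrite !(ev_coef _ _ (leqnn _)) -sumrB.
apply: (uabs_sum_le uP) => [|i _]; first exact: uabs_ge0 uP _.
rewrite -mulrBr subrXX mulrCA (uabsM uP) ler_piMr ?(uabs_ge0 uP) //.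
rewrite (uabsM uP) (vext_io nP) mulr_ile1 ?(uabs_ge0 uP) ?(uabs_ge0 vP) //.
apply: (uabs_sum_le uP) => // j _.
by rewrite (uabsM uP) !(uabsX uP) mulr_ile1 ?exprn_ile1 ?exprn_ge0 ?(uabs_ge0 uP).
Qed.

End Integral.

Section Disk.
Variables (K : fieldType) (io : {rmorphism L -> K}) (n : K -> R).
Variables (E : fieldType) (jo : {rmorphism L -> E}) (m : E -> R).
Hypotheses (nP : vext v io n) (mP : vext v jo m).
Variables (y : K) (z : E) (r delta : R).
Hypothesis hz : forall a, m (z - jo a) = Num.max (n (y - io a)) r.

Let uP : ultra_abs n. Proof. by case: nP. Qed.
Let wP : ultra_abs m. Proof. by case: mP. Qed.

(** By [hz], each linear factor of [f] can only grow from [y] to [z]. *)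
Lemma disk_ev_ge f : n (ev io f y) <= m (ev jo f z).
Proof.
rewrite -[leLHS]/(pt io n y f) -[leRHS]/(pt jo m z f).
rewrite (pt_lin_ext nP) (pt_lin_ext mP) ler_wpM2l ?(uabs_ge0 vP) //.
by apply: ler_prod => a _; rewrite (uabs_ge0 uP) hz le_max lexx.
Qed.

Variables p q : {poly L}.
Hypotheses (pint : coefs_le1 p) (qint : coefs_le1 q).
Hypothesis nozero : forall a, v a <= 1 -> ~ (v p.[a] < 1 /\ v q.[a] < 1).
Hypothesis y1 : n y <= 1.
Hypothesis yL : forall a, y != io a.
Hypothesis yfix : forall a, n (ev io p y / ev io q y - io a) = n (y - io a).
Hypothesis delta0 : 0 < delta.
Hypothesis delta_le : forall a, delta <= n (y - io a).
Hypothesis delta_inf : forall e, delta < e -> exists a, n (y - io a) < e.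
Hypotheses (delta_r : delta < r) (r1 : r <= 1).

Let y_near a : n (y - io a) <= 1 -> v a <= 1.
Proof.
move=> h; rewrite -(vext_io nP) -[io a](subKr y) (le_trans (uabsB uP _ _)) //.
by rewrite ge_max y1.
Qed.

(** As [y] is fixed and [n y <= 1], the value of [p] at [y] is no larger than that of [q]. If the
    latter were below 1, both would be below 1 at a point [a] of [L] with [n (y - a) < 1], against
    good reduction. *)
Let qy1 : n (ev io q y) = 1.
Proof.
have [a ya] := delta_inf (lt_le_trans delta_r r1).
have a1 := y_near (ltW ya).
have ia1 : n (io a) <= 1 by rewrite (vext_io nP).
have qy0 : ev io q y != 0.
  (* Were [q] zero at [y], the quotient would be 0 by the convention on inverses, and fixedness
     would force [y = 0]. *)
  apply/eqP => q0; have := yfix 0; rewrite q0 invr0 mulr0 rmorph0 !subr0.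
  rewrite (uabs0 uP) => /esym/eqP; rewrite (uabs_eq0 uP) => /eqP y0.
  by have := yL 0; rewrite y0 rmorph0 eqxx.
have py : n (ev io p y) <= n (ev io q y).
  have := yfix 0; rewrite rmorph0 !subr0 => h.
  by rewrite -[ev io p y](divfK qy0) (uabsM uP) h ler_piMl ?(uabs_ge0 uP).
apply: le_anti; rewrite (integral_ev_le1 nP qint y1) /= leNgt; apply/negP => q1.
apply: (nozero a1).
have aux f : coefs_le1 f -> n (ev io f y) < 1 -> v f.[a] < 1.
  move=> fint f1; rewrite -(vext_io nP) -ev_io -[ev io f (io a)](subKr (ev io f y)).
  apply: le_lt_trans (uabsB uP _ _) _; rewrite gt_max f1 /=.
  exact: le_lt_trans (integral_ev_lip nP fint y1 ia1) ya.
by split; apply: aux => //; exact: le_lt_trans q1.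
Qed.

Let q_near a : n (y - io a) < 1 -> v q.[a] = 1.
Proof.
move=> ya; rewrite -(vext_io nP) -ev_io -qy1; apply: (uabsB_eq uP).
rewrite qy1; apply: le_lt_trans (ya); apply: (integral_ev_lip nP) => //.
by rewrite (vext_io nP) y_near // ltW.
Qed.

Let z1 : m z <= 1.
Proof. by have := hz 0; rewrite !rmorph0 !subr0 => ->; rewrite ge_max y1. Qed.

Let qz1 : m (ev jo q z) = 1.
Proof.
apply: le_anti; rewrite (integral_ev_le1 mP qint z1) /= -qy1.
exact: disk_ev_ge.
Qed.

Let psi b := p.[b] / q.[b].
(** The numerator of [p / q - psi b]. It has coefficients of size at most 1 when [b] lies in the
    unit disk, and it vanishes at [b]. *)
Let res b := q.[b] *: p - p.[b] *: q.

Let res_norm (M : fieldType) (ko : {rmorphism L -> M}) (k : M -> R) t b :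
  vext v ko k -> k (ev ko q t) = 1 -> v q.[b] = 1 ->
  k (ev ko p t / ev ko q t - ko (psi b)) = k (ev ko (res b) t).
Proof.
move=> kP qt qb; have uk : ultra_abs k by case: kP.
have qt0 : ev ko q t != 0 by rewrite -(uabs_eq0 uk) qt oner_eq0.
have qb0 : ko q.[b] != 0 by rewrite -(uabs_eq0 uk) (vext_io kP) qb oner_eq0.
have -> : ev ko p t / ev ko q t - ko (psi b) =
    ev ko (res b) t * (ev ko q t * ko q.[b])^-1.
  rewrite /psi fmorph_div evB !evZ; field.
  by rewrite ?qt0 ?qb0.
by rewrite (uabsM uk) (uabsV _ uk) (uabsM uk) qt (vext_io kP) qb mulr1 invr1 mulr1.
Qed.

Let res_int b : v b <= 1 -> coefs_le1 (res b).
Proof.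
move=> b1 i; rewrite coefB !coefZ (le_trans (uabsB vP _ _)) // ge_max !(uabsM vP).
have ib : n (io b) <= 1 by rewrite (vext_io nP).
have qb := integral_ev_le1 nP qint ib; have pb := integral_ev_le1 nP pint ib.
move: qb pb; rewrite !ev_io !(vext_io nP) => qb pb.
by rewrite !mulr_ile1 ?(uabs_ge0 vP).
Qed.

Let res_root b : (res b).[b] = 0.
Proof. by rewrite /res !hornerE mulrC subrr. Qed.

Let psi_lip (M : fieldType) (ko : {rmorphism L -> M}) (k : M -> R) t b :
  vext v ko k -> k (ev ko q t) = 1 -> v q.[b] = 1 -> v b <= 1 -> k t <= 1 ->
  k (ev ko p t / ev ko q t - ko (psi b)) <= k (t - ko b).
Proof.
move=> kP qt qb b1 t1; rewrite res_norm //.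
have kb : k (ko b) <= 1 by rewrite (vext_io kP).
have := integral_ev_lip kP (res_int b1) t1 kb.
by rewrite ev_io res_root rmorph0 subr0.
Qed.

(* [psi - psi b] has a zero at [b], so passing from [y] to the disk of radius
   [r] multiplies its size by at least [r / n (y - b)]. *)
Let psi_expand b : n (y - io b) < r ->
  r * delta <= m (ev jo p z / ev jo q z - jo (psi b)) * n (y - io b).
Proof.
move=> br; have b1 := lt_le_trans br r1.
have /factor_theorem [g rg] : root (res b) b by apply/rootP/res_root.
have zb : m (z - jo b) = r by rewrite hz max_r // ltW.
apply: (@le_trans _ _ (r * n (ev io (res b) y))).
  rewrite ler_wpM2l ?(le_trans (ltW delta0) (ltW delta_r)) //.
  by rewrite -res_norm ?q_near // yfix.
rewrite res_norm ?q_near // rg !evM !evB !evX !evC (uabsM uP) (uabsM wP) zb.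
rewrite mulrCA mulrA ler_wpM2r ?(uabs_ge0 uP) // ler_wpM2r ?disk_ev_ge //.
exact: le_trans (ltW delta0) (ltW delta_r).
Qed.

(** The upper bound holds because the map is non-expanding on the residue disk of [y]. The lower
    bound is a maximum of two: [n (y - a)], by monotonicity from [y] to [z], and [r], by
    [psi_expand]. *)
Lemma disk_fixed a : m (ev jo p z / ev jo q z - jo a) = m (z - jo a).
Proof.
set W := ev jo p z / ev jo q z.
have r0 := lt_trans delta0 delta_r.
apply: le_anti; apply/andP; split.
  (* Compare through [psi b] with [n (y - b) < r]: it is within [r] of the image of [z] and of the
     image of [y], and the latter has the same distance to [a] as [y]. *)
  have [b br] := delta_inf delta_r; have b1 := lt_le_trans br r1.
  have vb := y_near (ltW b1).
  apply: le_trans (uabsB_trans wP (jo (psi b)) _ _) _.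
  rewrite ge_max; apply/andP; split.
    rewrite (le_trans (psi_lip mP qz1 (q_near b1) vb z1)) // !hz.
    by rewrite (max_r (ltW br)) le_max lexx orbT.
  rewrite -rmorphB (vext_io mP) -(vext_io nP) rmorphB hz.
  apply: le_trans (uabsB_trans uP (ev io p y / ev io q y) _ _) _.
  rewrite ge_max yfix (uabsBC uP) !le_max lexx andbT.
  by rewrite (le_trans (psi_lip nP qy1 (q_near b1) vb y1) (ltW br)) orbT.
have Wge : n (y - io a) <= m (W - jo a).
  (* Divide by [q], which has size 1 at both [y] and [z]. *)
  have := disk_ev_ge (p - a *: q); rewrite !evB !evZ.
  have qz0 : ev jo q z != 0 by rewrite -(uabs_eq0 wP) qz1 oner_eq0.
  have qy0 : ev io q y != 0 by rewrite -(uabs_eq0 uP) qy1 oner_eq0.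
  have -> : ev jo p z - jo a * ev jo q z = (W - jo a) * ev jo q z.
    by rewrite mulrBl divfK.
  have -> : ev io p y - io a * ev io q y =
      (ev io p y / ev io q y - io a) * ev io q y by rewrite mulrBl divfK.
  by rewrite (uabsM wP) (uabsM uP) qz1 qy1 !mulr1 yfix.
rewrite hz ge_max Wge /= leNgt; apply/negP => Wr.
set M := m (W - jo a) in Wge Wr *.
have M0 : delta <= M := le_trans (delta_le a) Wge.
have Mp := lt_le_trans delta0 M0.
have rM : 1 < r / M by rewrite ltr_pdivlMr ?mul1r.
(* Suppose [M < r], so that [k > 1] and [k^2 M = r]. For [b] with [rho = n (y - b) < k delta], the
   image of [z] is within [max M rho <= k M] of [psi b], and [psi_expand] yields [r delta <= k M rho
   < k^2 M delta = r delta]. *)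
pose k := Num.sqrt (r / M).
have k0 : 0 <= k by apply: sqrtr_ge0.
have k2 : k * k * M = r.
  by rewrite -expr2 sqr_sqrtr ?divfK ?lt0r_neq0 // ltW // (lt_trans ltr01).
have k1 : 1 < k by rewrite -sqrtr1 ltr_sqrt // (lt_trans ltr01).
have [b bd] : exists b, n (y - io b) < k * delta.
  by apply: delta_inf; rewrite ltr_pMl.
set rho := n (y - io b) in bd *.
have kMr : k * M < r by rewrite -k2 -mulrA ltr_pMl // mulr_gt0 // (lt_trans ltr01).
have kd : k * delta <= k * M by rewrite ler_wpM2l.
have br : rho < r by rewrite (lt_trans bd) // (le_lt_trans kd).
have b1 := lt_le_trans br r1; have vb := y_near (ltW b1).
have rd := delta_le b; rewrite -/rho in rd.
have := psi_expand br; rewrite -/W -/rho.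
have Wb : m (W - jo (psi b)) <= Num.max M rho.
  apply: le_trans (uabsB_trans wP (jo a) _ _) _.
  rewrite ge_max le_max lexx /= -rmorphB (vext_io mP) -(vext_io nP) rmorphB.
  apply: le_trans (uabsB_trans uP (ev io p y / ev io q y) _ _) _.
  rewrite ge_max le_max (uabsBC uP) yfix Wge /= le_max.
  by rewrite (psi_lip nP qy1 (q_near b1) vb y1) orbT.
have rho0 : 0 < rho := lt_le_trans delta0 rd.
have {}Wb : m (W - jo (psi b)) <= k * M.
  apply: le_trans Wb _; rewrite ge_max ler_peMl ?(ltW k1) ?(ltW Mp) //=.
  exact: le_trans (ltW bd) kd.
move=> h; have : r * delta < r * delta.
  apply: le_lt_trans h _; apply: le_lt_trans (ler_wpM2r (ltW rho0) Wb) _.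
  have -> : r * delta = k * M * (k * delta) by rewrite -[in LHS]k2; ring.
  by rewrite ltr_pM2l // mulr_gt0 // (lt_trans ltr01).
by rewrite ltxx.
Qed.

End Disk.
End Core.

(** * Change of coordinate *)

Definition mob (K : fieldType) (a b c e x : K) : K := (a * x + b) / (c * x + e).

Lemma mob_cancel (K : fieldType) (a b c e x : K) :
  a * e - b * c != 0 -> c * x + e != 0 ->
  mob e (- b) (- c) a (mob a b c e x) = x.
Proof.
move=> det den; rewrite /mob.
have -> : e * ((a * x + b) / (c * x + e)) + - b =
    x * ((a * e - b * c) / (c * x + e)) by field.
have -> : - c * ((a * x + b) / (c * x + e)) + a =
    (a * e - b * c) / (c * x + e) by field.
by rewrite mulfK // mulf_neq0 ?invr_eq0.
Qed.

Section Transcendental.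
Variables (L K : fieldType) (io : {rmorphism L -> K}).
Implicit Types (a b c e : L) (x z : K).

Lemma lin_neq0 c e z : (forall a, z != io a) -> (c != 0) || (e != 0) ->
  io c * z + io e != 0.
Proof.
move=> zL; have [->|c0 _] := eqVneq c 0.
  by rewrite rmorph0 mul0r add0r fmorph_eq0.
rewrite addr_eq0 -rmorphN; apply: contraNneq (zL (- e / c)) => h.
by rewrite fmorph_div -h mulrC mulKf // fmorph_eq0.
Qed.

Lemma det_row2 a b c e : a * e - b * c != 0 -> (c != 0) || (e != 0).
Proof.
apply: contraNT; rewrite negb_or !negbK => /andP[/eqP-> /eqP->].
by rewrite !mulr0 subrr.
Qed.

Lemma det_row1 a b c e : a * e - b * c != 0 -> (a != 0) || (b != 0).
Proof.
apply: contraNT; rewrite negb_or !negbK => /andP[/eqP-> /eqP->].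
by rewrite !mul0r subrr.
Qed.

Lemma mob_notin a b c e x : a * e - b * c != 0 -> (forall l, x != io l) ->
  forall l, mob (io a) (io b) (io c) (io e) x != io l.
Proof.
move=> det xL l; have den := lin_neq0 xL (det_row2 det).
rewrite -subr_eq0 /mob.
have -> : (io a * x + io b) / (io c * x + io e) - io l =
    (io (a - l * c) * x + io (b - l * e)) / (io c * x + io e).
  by rewrite !rmorphB !rmorphM /=; field.
rewrite mulf_neq0 ?invr_eq0 // lin_neq0 // (@det_row1 _ _ c e) //.
by have -> : (a - l * c) * e - (b - l * e) * c = a * e - b * c by ring.
Qed.

End Transcendental.

Section Valued.
Variables (R : realType) (L : fieldType) (v : L -> R).

Section TwoPoints.
Variables (K E : fieldType) (io : {rmorphism L -> K}) (jo : {rmorphism L -> E}).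
Variables (n : K -> R) (m : E -> R) (x : K) (w : E).
Hypotheses (nP : ultra_abs n) (nio : forall a, n (io a) = v a).
Hypotheses (mP : ultra_abs m) (mjo : forall a, m (jo a) = v a).
Hypothesis same : forall a, n (x - io a) = m (w - jo a).

Lemma same_lin a b : n (io a * x + io b) = m (jo a * w + jo b).
Proof.
have [->|a0] := eqVneq a 0; first by rewrite !rmorph0 !mul0r !add0r nio mjo.
have -> : io a * x + io b = io a * (x - io (- b / a)).
  rewrite fmorph_div rmorphN; field; by rewrite fmorph_eq0.
have -> : jo a * w + jo b = jo a * (w - jo (- b / a)).
  rewrite fmorph_div rmorphN; field; by rewrite fmorph_eq0.
by rewrite (uabsM nP) (uabsM mP) same nio mjo.
Qed.

(** Elements with the same distances to [L] define the same point, and homographies respect this: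
    the difference with [f] is a quotient of two linear forms over [L], whose sizes agree by
    [same_lin]. *)
Lemma mob_same a b c e : io c * x + io e != 0 -> forall f,
  n (mob (io a) (io b) (io c) (io e) x - io f) =
  m (mob (jo a) (jo b) (jo c) (jo e) w - jo f).
Proof.
move=> xden f.
have wden : jo c * w + jo e != 0.
  by rewrite -(uabs_eq0 mP) -same_lin (uabs_eq0 nP).
have aux (M : fieldType) (ko : {rmorphism L -> M}) t : ko c * t + ko e != 0 ->
    mob (ko a) (ko b) (ko c) (ko e) t - ko f =
    (ko (a - f * c) * t + ko (b - f * e)) / (ko c * t + ko e).
  by move=> den; rewrite /mob !rmorphB !rmorphM /=; field.
rewrite !aux // (uabsM nP) (uabsM mP) (uabsV _ nP) (uabsV _ mP).
by rewrite !same_lin.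
Qed.

End TwoPoints.
End Valued.

(** The reciprocal polynomial of formal degree [d], which describes the form [p] in the chart at
    infinity. *)
Definition rev_poly (L : fieldType) (d : nat) (p : {poly L}) : {poly L} :=
  \poly_(i < d.+1) p`_(d - i).

Section Forms.
Variables (L : fieldType) (d : nat).

Lemma hev_x1 (p : {poly L}) a : (size p <= d.+1)%N -> hev d p a 1 = p.[a].
Proof.
move=> sp; rewrite (horner_coef_wide _ sp); apply: eq_bigr => i _.
by rewrite expr1n mulr1.
Qed.

Lemma hev_1x (p : {poly L}) a : hev d p 1 a = (rev_poly d p).[a].
Proof.
rewrite horner_poly (reindex_inj rev_ord_inj) /=; apply: eq_bigr => i _.
by rewrite expr1n mulr1 subSS subKn // -ltnS.
Qed.

Lemma rev_poly_ev (K : fieldType) (io : {rmorphism L -> K}) (p : {poly L}) z :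
  z != 0 -> (size p <= d.+1)%N ->
  ev io (rev_poly d p) z = z ^+ d * ev io p z^-1.
Proof.
move=> z0 sp; rewrite (ev_coef _ _ sp) (ev_coef _ _ (size_poly _ _)) mulr_sumr.
rewrite (reindex_inj rev_ord_inj) /=; apply: eq_bigr => i _.
have id : (i <= d)%N by rewrite -ltnS.
rewrite coef_poly subSS ltnS leq_subr subKn // mulrCA; congr (_ * _).
by rewrite exprVn -exprB // unitfE.
Qed.

Lemma size_hcomp (h P Q : {poly L}) : (size P <= 2)%N -> (size Q <= 2)%N ->
  (size (hcomp d h P Q) <= d.+1)%N.
Proof.
move=> sP sQ; apply: (leq_trans (size_sum _ _ _)); apply/bigmax_leqP => i _.
apply: (leq_trans (size_scale_leq _ _)); apply: (leq_trans (size_polyMleq _ _)).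
have aux (p : {poly L}) k : (size p <= 2)%N -> (size (p ^+ k) <= k.+1)%N.
  move=> sp; apply: (leq_trans (size_poly_exp_leq _ _)); rewrite ltnS.
  rewrite -[leqRHS]mul1n leq_mul2r.
  by case: (size p) sp => [|[|[]]] //=; rewrite orbT.
have h1 := aux _ i sP; have h2 := aux _ (d - i)%N sQ.
have id : (i <= d)%N by rewrite -ltnS.
rewrite -subn1 leq_subLR add1n; apply: leq_trans (leq_add h1 h2) _.
by rewrite addSn addnS subnKC.
Qed.

End Forms.

Section Model.
Variables (R : realType) (L : closedFieldType) (v : L -> R).
Variables (d : nat) (F G : {poly L}).

(* [p / q] represents the conjugate of [F / G] by the homography
   [(a z + b) / (c z + e)] and has good reduction on the closed unit disk. *)
Definition good_model (a b c e : L) (p q : {poly L}) : Prop :=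
  [/\ a * e - b * c != 0, coefs_le1 v p, coefs_le1 v q,
      (forall l, v l <= 1 -> ~ (v p.[l] < 1 /\ v q.[l] < 1)) &
      forall (K : fieldType) (io : {rmorphism L -> K}) (z : K),
        (forall l, z != io l) ->
        let x := mob (io e) (- io b) (- io c) (io a) z in
        ev io p z / ev io q z =
          mob (io a) (io b) (io c) (io e) (ev io F x / ev io G x)].

Hypothesis vP : ultra_abs v.
Hypotheses (sF : (size F <= d.+1)%N) (sG : (size G <= d.+1)%N) (G0 : G != 0).

(** The second model is the first one conjugated by [1 / z]: the rows of the matrix are exchanged
    and [p], [q] become the reversals of [q], [p]. The absence of common zeros at [(l : 1)] serves
    the first model, at [(1 : l)] the second. *)
Lemma good_models : potential_good_reduction v d F G ->
  exists a b c e p q p' q',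
    good_model a b c e p q /\ good_model c e a b p' q'.
Proof.
case=> a [b [c [e [det [lam [lam0 Pint Qint _ nz]]]]]].
move: Pint Qint nz; rewrite /conj_forms /=.
set U := e *: 'X - b%:P; set W := - c *: 'X + a%:P.
set P := a *: _ + _; set Q := c *: _ + _ => Pint Qint nz.
have sU : (size U <= 2)%N.
  rewrite (leq_trans (size_polyD _ _)) // geq_max size_polyN.
  rewrite (leq_trans (size_scale_leq _ _)) ?size_polyX //.
  by rewrite (leq_trans (size_polyC_leq1 _)).
have sW : (size W <= 2)%N.
  rewrite (leq_trans (size_polyD _ _)) // geq_max.
  rewrite (leq_trans (size_scale_leq _ _)) ?size_polyX //.
  by rewrite (leq_trans (size_polyC_leq1 _)).
pose p := lam *: P; pose q := lam *: Q.
have sp : (size p <= d.+1)%N.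
  rewrite (leq_trans (size_scale_leq _ _)) // (leq_trans (size_polyD _ _)) //.
  by rewrite geq_max !(leq_trans (size_scale_leq _ _)) // size_hcomp.
have sq : (size q <= d.+1)%N.
  rewrite (leq_trans (size_scale_leq _ _)) // (leq_trans (size_polyD _ _)) //.
  by rewrite geq_max !(leq_trans (size_scale_leq _ _)) // size_hcomp.
have pint : coefs_le1 v p by move=> i; rewrite coefZ.
have qint : coefs_le1 v q by move=> i; rewrite coefZ.
have rint f : coefs_le1 v f -> coefs_le1 v (rev_poly d f).
  by move=> fint i; rewrite coef_poly; case: ifP => // _; rewrite (uabs0 vP).
have hevZ f s t : lam * hev d f s t = hev d (lam *: f) s t.
  by rewrite /hev mulr_sumr; apply: eq_bigr => i _; rewrite coefZ !mulrA.
have conj (K : fieldType) (io : {rmorphism L -> K}) (z : K) :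
    (forall l, z != io l) ->
    let x := mob (io e) (- io b) (- io c) (io a) z in
    ev io p z / ev io q z = mob (io a) (io b) (io c) (io e) (ev io F x / ev io G x).
  move=> zL x.
  have det' : e * a - - b * - c != 0 by rewrite mulrNN [e * a]mulrC.
  have xL l : x != io l by rewrite /x -!rmorphN; apply: mob_notin.
  have Gx : ev io G x != 0 by apply: ev_neq0.
  have Wz : ev io W z != 0.
    rewrite evD evZ evX evC lin_neq0 //.
    exact: (@det_row2 L e (- b)).
  have xE : ev io U z / ev io W z = x.
    by rewrite /x /mob evB evD !evZ !evX !evC rmorphN mulNr.
  rewrite !evZ !evD !evZ !hcomp_ev // xE /mob.
  set f := ev io F x; set g := ev io G x in Gx *; set k := ev io W z ^+ d.
  have k0 : k != 0 by rewrite expf_neq0.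
  have l0 : io lam != 0 by rewrite fmorph_eq0.
  (* The factor [lam W(z)^d G(x)] is common to numerator and denominator and cancels. *)
  have aux s t : io lam * (io s * (k * f) + io t * (k * g)) =
      (io s * (f / g) + io t) * (io lam * k * g) by field.
  by rewrite !aux -mulf_div divff ?mulr1 // !mulf_neq0.
exists a, b, c, e, p, q, (rev_poly d q), (rev_poly d p); split.
  split=> // l l1 [hp hq]; apply: (nz l 1); first by rewrite (uabs1 vP) max_r.
  by rewrite !hevZ !hev_x1.
split=> [|||l l1 [hq hp]|K io z zL x].
- have -> : c * b - e * a = - (a * e - b * c) by ring.
  by rewrite oppr_eq0.
- exact: rint.
- exact: rint.
- by apply: (nz 1 l); rewrite ?(uabs1 vP) ?max_l // !hevZ !hev_1x.
have z0 : z != 0 by rewrite -(rmorph0 io).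
have zL' l : z^-1 != io l.
  by rewrite -(inj_eq invr_inj) invrK -fmorphV.
have xE : x = mob (io e) (- io b) (- io c) (io a) z^-1.
  rewrite /x /mob.
  have -> : io e * z^-1 - io b = (io b * z - io e) * - z^-1 by field.
  have -> : - io c * z^-1 + io a = (- io a * z + io c) * - z^-1 by field.
  by rewrite -mulf_div divff ?mulr1 // oppr_eq0 invr_eq0.
rewrite !rev_poly_ev // -mulf_div divff ?expf_neq0 // mul1r -invf_div conj // -xE.
by rewrite /mob invf_div.
Qed.

End Model.

(** * Paths to the Gauss point *)

Section Topology.
Local Open Scope classical_set_scope.
Variables (R : realType) (L : fieldType) (v : L -> R).

(** In the weak topology a path is continuous as soon as each [P r h] is continuous in [r], since a
    box imposes finitely many open conditions; the connectedness of the real segment then transfers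
    to its image. *)
Lemma connectedP_path (P : R -> {poly L} -> R) (a b : R) :
  (forall r, mult_seminorm v (P r)) ->
  (forall h, continuous (fun r => P r h)) ->
  connectedP v (fun z => exists2 r, a <= r <= b & z = Some (P r)).
Proof.
move=> Psn Pcont.
have open_pre W : openP v W -> open [set r | W (Some (P r))].
  case=> _ oW _; rewrite openE => r Wr.
  have [_ [l [sl hl]]] := oW _ Wr.
  have : \forall r' \near r, sat_box l (P r').
    elim: l sl {hl} => [|[[f lo] hi] l IH] sl; first by near=> r' => t [].
    have /= /andP[flo fhi] := sl (f, lo, hi) (or_introl erefl).
    have {}IH := IH (fun t tl => sl t (or_intror tl)).
    near=> r' => t [<- /=|]; last by move: t; near: r'.
    apply/andP; split; near: r'; [exact: cvgr_gt (Pcont f r) _ flo |].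
    exact: cvgr_lt (Pcont f r) _ fhi.
  by apply: filterS => r' /(hl _ (Psn r')).
move=> U V oU oV cover disj [_ [[u ub ->] Uu]] [_ [[w wb ->] Vw]].
pose B := `[a, b] `&` [set r | U (Some (P r))].
have : B = `[a, b]%classic.
  apply: segment_connected; first by exists u; split=> //=; rewrite in_itv.
    by exists [set r | U (Some (P r))] => //; apply: open_pre.
  (* On the segment the preimage of [U] is the complement of that of [V], hence also closed. *)
  exists (~` [set r | V (Some (P r))]).
    by apply: open_closedC; apply: open_pre.
  apply/seteqP; split=> r [rab hr]; split=> //=.
    by move=> Vr; apply: (disj _ _ hr Vr); exists r.
  by case: (cover (Some (P r))) => //; exists r.
move/seteqP => [_ /(_ w)]; rewrite /= in_itv /= => /(_ wb) [_ Uw].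
by apply: (disj _ _ Uw Vw); exists w.
Unshelve. all: by end_near.
Qed.

Lemma same_component_refl (A : berk_pt R L -> Prop) z :
  A z -> same_component v A z z.
Proof.
move=> Az; exists (eq z); split; first by move=> _ <-.
split=> // U V _ _ _ disj [_ [<- Uz]] [_ [<- Vz]].
exact: (disj z).
Qed.

Lemma same_component_join (A : berk_pt R L -> Prop) x y g :
  same_component v A x g -> same_component v A y g -> same_component v A x y.
Proof.
case=> [C [CA [Cc [Cx Cg]]]] [D [DA [Dc [Dy Dg]]]].
exists (fun z => C z \/ D z); split; first by move=> z [/CA|/DA].
split; last by split; [left | right].
move=> U V oU oV cover disj hU hV.
have half (X : berk_pt R L -> Prop) (W W' : berk_pt R L -> Prop) :
    connectedP v X -> (forall z, X z -> C z \/ D z) -> X g -> openP v W ->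
    openP v W' -> (forall z, X z -> W z \/ W' z) ->
    (forall z, X z -> W z -> W' z -> False) -> W g -> forall z, X z -> W' z -> False.
  move=> Xc XCD Xg oW oW' cov dis Wg z Xz W'z.
  by apply: (Xc W W') => //; [exists g | exists z].
have key (W W' : berk_pt R L -> Prop) : openP v W -> openP v W' ->
    (forall z, C z \/ D z -> W z \/ W' z) ->
    (forall z, C z \/ D z -> W z -> W' z -> False) -> W g ->
    (exists z, (C z \/ D z) /\ W' z) -> False.
  move=> oW oW' cov dis Wg [z [[Cz|Dz] W'z]].
    by apply: (half C W W') Cz W'z => // t; [left | move=> ? ; apply: cov; left
      | move=> ?; apply: dis; left].
  by apply: (half D W W') Dz W'z => // t; [right | move=> ? ; apply: cov; right
      | move=> ?; apply: dis; right].
case: (cover g (or_introl Cg)) => [Ug|Vg]; first exact: (key U V).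
apply: (key V U) => // [z /cover[]|z CDz Vz Uz]; [by right | by left |].
exact: disj CDz Uz Vz.
Qed.

Lemma distance_to_base (K : fieldType) (io : {rmorphism L -> K}) (n : K -> R) (y : K) :
  complete_absval v -> ultra_abs n -> (forall c, n (io c) = v c) ->
  (forall a, y != io a) ->
  exists delta, [/\ 0 < delta, forall a, delta <= n (y - io a) &
    forall e, delta < e -> exists a, n (y - io a) < e].
Proof.
move=> vcomp nP nio yL; pose S := [set t | exists a, t = n (y - io a)].
have lbS : lbound S 0 by move=> _ [a ->]; apply: uabs_ge0.
have infS : has_inf S by split; [exists (n (y - io 0)), 0 | exists 0].
have S0 : 0 <= inf S by apply: lb_le_inf => //; case: infS.
have adh (e : R) : inf S < e -> exists a, n (y - io a) < e.
  by rewrite -subr_gt0 => /inf_adherent/(_ infS) [_ [a ->]]; rewrite subrKC; exists a.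
exists (inf S); split=> // [|a]; last by apply: ge_inf; [case: infS | exists a].
rewrite lt_def S0 andbT; apply/eqP => inf0.
(* If the infimum were 0, a sequence in [L] would tend to [y]; it is Cauchy, and its limit in [L]
   would equal [y]. *)
have [u hu] : {u : nat -> L & forall k, n (y - io (u k)) < k.+1%:R^-1}.
  apply: (@choice _ _ (fun k a => n (y - io a) < k.+1%:R^-1)) => k.
  by apply: adh; rewrite inf0 invr_gt0 ltr0n.
have small (e : R) : 0 < e -> exists N, forall k, (N <= k)%N -> n (y - io (u k)) < e.
  move=> e0; exists (Num.truncn e^-1) => k Nk; apply: lt_le_trans (hu k) _.
  rewrite -[leRHS]invrK lef_pV2 ?posrE ?invr_gt0 ?ltr0n // ltW //.
  by apply: lt_le_trans (truncnS_gt _) _; rewrite ler_nat.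
case: (vcomp u) => [e /small [N hN]|l hl].
  exists N => i j Ni Nj; rewrite -nio rmorphB.
  apply: le_lt_trans (uabsB_trans nP y _ _) _.
  by rewrite gt_max (uabsBC nP) !hN.
have : n (y - io l) <= 0.
  apply/ler_addgt0Pl => e e0; rewrite addr0.
  have [N hN] := small e e0; have [M hM] := hl e e0.
  apply: le_trans (uabsB_trans nP (io (u (maxn N M))) _ _) _.
  rewrite ge_max ltW ?hN ?leq_maxl //= -rmorphB nio ltW // hM //.
  exact: leq_maxr.
by rewrite leNgt (uabs_gt0 nP) subr_eq0 yL.
Qed.

End Topology.

Section Path.
Local Open Scope classical_set_scope.
Variables (R : realType) (L : closedFieldType) (v : L -> R).
Hypothesis vP : ultra_abs v.

Lemma continuous_max_affine (A B delta : R) :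
  continuous (fun r : R => Num.max A (B * Num.max r delta)).
Proof.
move=> r.
apply: (@continuous_max R R (fun=> A) (fun r => B * Num.max r delta)).
  exact: cst_continuous.
apply: (@continuousM R R (fun=> B) (fun r => Num.max r delta)).
  exact: cst_continuous.
apply: (@continuous_max R R id (fun=> delta)); last exact: cst_continuous.
exact: cvg_id.
Qed.

Lemma lin_ext_continuous (l : R -> L -> R) (h : {poly L}) :
  (forall a, continuous (fun r => l r a)) ->
  continuous (fun r => lin_ext v (l r) h).
Proof.
move=> lc.
have pc (s : seq L) : continuous (fun r => \prod_(a <- s) l r a).
  elim: s => [|a s IH].
    have -> : (fun r => \prod_(a <- [::]) l r a) = fun=> 1.
      by apply: funext => t; rewrite big_nil.
    exact: cst_continuous.
  have -> : (fun r => \prod_(b <- a :: s) l r b) =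
      (fun r => l r a * \prod_(b <- s) l r b).
    by apply: funext => t; rewrite big_cons.
  by move=> r; apply: continuousM; [apply: lc | apply: IH].
by move=> r; apply: continuousM; [apply: cst_continuous | apply: pc].
Qed.

(* Values on [T - f] of the preimage, under the homography
   [(a z + b) / (c z + e)], of the Gauss point. *)
Definition gauss_value (a b c e f : L) : R :=
  Num.max (v (e + f * c)) (v (b + f * a)) / Num.max (v a) (v c).

(** Exchanging the rows composes the homography with [1 / z], which preserves the Gauss point; so
    both models lead to the same end point. *)
Lemma gauss_valueC a b c e : gauss_value a b c e = gauss_value c e a b.
Proof. by apply: funext => f; congr (_ / _); apply: maxC. Qed.

Section Disk.
Variables (K : fieldType) (io : {rmorphism L -> K}) (n : K -> R).
Hypothesis nP : vext v io n.
Let uP : ultra_abs n. Proof. by case: nP. Qed.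

Lemma preimage_value a b c e z : a * e - b * c != 0 ->
  (forall l, z != io l) -> forall f,
  n (mob (io e) (- io b) (- io c) (io a) z - io f) =
    n (io (e + f * c) * z + io (- (b + f * a))) / n (io (- c) * z + io a).
Proof.
move=> det zL f; have den : io (- c) * z + io a != 0.
  rewrite lin_neq0 // oppr_eq0 orbC.
  by apply: (@det_row1 _ a c b e); rewrite [c * b]mulrC.
rewrite -(uabsV _ uP) -(uabsM uP); congr n.
rewrite /mob; move: den; rewrite !rmorphN !rmorphD !rmorphM => den.
by field.
Qed.

Variables (y : K).
Hypothesis yL : forall a, y != io a.

Section DiskPoint.
Variables (E : fieldType) (jo : {rmorphism L -> E}) (m : E -> R) (z : E) (r : R).
Hypotheses (mP : vext v jo m) (r0 : 0 < r).
Hypothesis hz : forall a, m (z - jo a) = Num.max (n (y - io a)) r.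
Let wP : ultra_abs m. Proof. by case: mP. Qed.

Lemma disk_notin l : z != jo l.
Proof. by rewrite -subr_eq0 -(uabs_gt0 wP) hz lt_max r0 orbT. Qed.

Lemma disk_lin a b :
  m (jo a * z + jo b) = Num.max (n (io a * y + io b)) (v a * r).
Proof.
have [->|a0] := eqVneq a 0.
  rewrite !rmorph0 !mul0r !add0r (vext_io nP) (vext_io mP) (uabs0 vP) mul0r.
  by rewrite max_l ?uabs_ge0.
have ja0 : jo a != 0 by rewrite fmorph_eq0.
have ia0 : io a != 0 by rewrite fmorph_eq0.
have -> : jo a * z + jo b = jo a * (z - jo (- b / a)).
  by rewrite fmorph_div rmorphN; field.
have -> : io a * y + io b = io a * (y - io (- b / a)).
  by rewrite fmorph_div rmorphN; field.
rewrite (uabsM wP) (uabsM uP) hz (vext_io nP) (vext_io mP).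
by rewrite maxr_pMr ?uabs_ge0.
Qed.

End DiskPoint.

(** With [r = delta] the maximum in [disk_lin] is therefore the value at [y]: the path starts at the
    point itself. *)
Lemma lin_ge_dist delta : (forall a, delta <= n (y - io a)) -> forall a b,
  v a * delta <= n (io a * y + io b).
Proof.
move=> hd a b; have [->|a0] := eqVneq a 0.
  by rewrite (uabs0 vP) mul0r uabs_ge0.
have ia0 : io a != 0 by rewrite fmorph_eq0.
have -> : io a * y + io b = io a * (y - io (- b / a)).
  by rewrite fmorph_div rmorphN; field.
by rewrite (uabsM uP) (vext_io nP) ler_wpM2l // (uabs_ge0 vP).
Qed.

(** With [r = 1] the maximum in [disk_lin] no longer depends on [y]: the path ends at the Gauss
    point. *)
Lemma lin_max a b : n y <= 1 ->
  Num.max (n (io a * y + io b)) (v a) = Num.max (v a) (v b).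
Proof.
move=> y1; have ay : n (io a * y) <= v a.
  by rewrite (uabsM uP) (vext_io nP) ler_piMr // (uabs_ge0 vP).
apply: le_anti; apply/andP; split; rewrite ge_max; apply/andP; split.
- apply: (le_trans (uabsD uP _ _)).
  by rewrite ge_max (vext_io nP) !le_max ay lexx orbT.
- by rewrite le_max lexx.
- by rewrite le_max lexx orbT.
have := uabsB uP (io a * y + io b) (io a * y); rewrite [_ + io b]addrC addrK.
rewrite (vext_io nP b) => /le_trans; apply.
by rewrite ge_max !le_max lexx ay orbT.
Qed.

End Disk.

(** * The path from a nonclassical fixed point to the Gauss point *)

Section Connect.
Variables (d : nat) (F G : {poly L}).
Hypothesis (G0 : G != 0).
Hypothesis vcomp : complete_absval v.
Variables (a b c e : L) (p q : {poly L}).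
Hypothesis model : good_model v F G a b c e p q.

Let det : a * e - b * c != 0. Proof. by case: model. Qed.
Let det' : e * a - - b * - c != 0. Proof. by rewrite mulrNN [e * a]mulrC. Qed.

(** Fixedness passes between the coordinates [z] and [x] by applying [mob_same] to the homography
    and to its inverse. *)
Lemma model_fixed (K : fieldType) (io : {rmorphism L -> K}) (n : K -> R) z :
  let x := mob (io e) (- io b) (- io c) (io a) z in
  vext v io n -> (forall l, z != io l) ->
  (forall f, n (ev io p z / ev io q z - io f) = n (z - io f)) <->
  (forall f, n (ev io F x / ev io G x - io f) = n (x - io f)).
Proof.
move=> x nP zL; have [uP nio] := nP; have [_ _ _ _ conj] := model.
have idet : io a * io e - io b * io c != 0.
  by rewrite -!rmorphM -rmorphB fmorph_eq0.
have zden : io (- c) * z + io a != 0 by apply: lin_neq0 (det_row2 det').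
have xL l : x != io l by rewrite /x -!rmorphN; apply: mob_notin.
have xden : io c * x + io e != 0 by apply: lin_neq0 (det_row2 det).
have zx : z = mob (io a) (io b) (io c) (io e) x.
  have := @mob_cancel _ (io e) (- io b) (- io c) (io a) z.
  by rewrite !opprK mulrNN [io e * _]mulrC => -> //; rewrite -rmorphN.
rewrite (conj _ io z zL) -/x; set w := ev io F x / ev io G x; split=> h f.
  (* A zero denominator would make the homography take the default value 0, and fixedness would give
     [z = 0], an element of [L]. *)
  have wden : io c * w + io e != 0.
    apply/eqP => w0; have := h 0; rewrite /mob w0 invr0 mulr0.
    move/eqP; rewrite eq_sym rmorph0 !subr0 (uabs0 uP) (uabs_eq0 uP).
    by rewrite -(rmorph0 io) (negPf (zL 0)).
  rewrite /x -(mob_cancel idet wden) -(rmorphN io b) -(rmorphN io c).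
  apply: (mob_same uP nio uP nio h).
  rewrite -(uabs_eq0 uP) (same_lin uP nio uP nio h).
  by rewrite (uabs_eq0 uP).
rewrite [in RHS]zx; apply: (mob_same uP nio uP nio h).
rewrite -(uabs_eq0 uP) (same_lin uP nio uP nio h).
by rewrite (uabs_eq0 uP).
Qed.

Variables (K : fieldType) (io : {rmorphism L -> K}) (n : K -> R) (x : K).
Hypotheses (nP : vext v io n) (xL : forall l, x != io l).
Hypothesis xfix : berk_fix v d F G (Some (pt io n x)).
Let y := mob (io a) (io b) (io c) (io e) x.
Hypothesis y1 : n y <= 1.

Lemma fixed_connected_gauss :
  same_component v (berk_fix v d F G) (Some (pt io n x))
    (Some (lin_ext v (gauss_value a b c e))).
Proof.
have [uP nio] := nP; have [_ pint qint nozero _] := model.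
have idet : io a * io e - io b * io c != 0.
  by rewrite -!rmorphM -rmorphB fmorph_eq0.
have yL l : y != io l by apply: mob_notin.
have xy : x = mob (io e) (- io b) (- io c) (io a) y.
  by rewrite mob_cancel // lin_neq0 // (det_row2 det).
have yfix f : n (ev io p y / ev io q y - io f) = n (y - io f).
  apply: (model_fixed nP yL).2; rewrite -xy.
  exact: (pt_fixP vP d F G0 nP xL).1 xfix.
have [delta [delta0 delta_le delta_inf]] := distance_to_base vcomp uP nio yL.
(* The value on [T - f] of the disk of radius [r] around [y], carried back to the original
   coordinate. Replacing [r] by [max r delta] freezes the path below [delta], so that every real [r]
   gives a seminorm, as [connectedP_path] demands. *)
pose l r f := Num.max (n (io (e + f * c) * y + io (- (b + f * a))))
    (v (e + f * c) * Num.max r delta) /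
  Num.max (n (io (- c) * y + io a)) (v (- c) * Num.max r delta).
have vN t : v (- t) = v t by apply: uabsN.
have d1 : delta <= 1.
  by apply: le_trans (delta_le 0) _; rewrite rmorph0 subr0.
have l1 : l 1 = gauss_value a b c e.
  apply: funext => f; rewrite /l (max_l d1) !mulr1.
  by rewrite !(lin_max nP) // !vN [X in _ / X]maxC.
have ld r : r <= delta -> lin_ext v (l r) = pt io n x.
  move=> rd; rewrite (pt_lin_ext nP); congr lin_ext; apply: funext => f.
  rewrite /l (max_r rd) !max_l ?(lin_ge_dist nP) //.
  by rewrite [in RHS]xy (preimage_value nP).
have disk r : delta < r -> exists (E : fieldType) (jo : {rmorphism L -> E}) m z,
    [/\ vext v jo m, forall f, m (z - jo f) = Num.max (n (y - io f)) r,
      forall f, z != jo f &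
      lin_ext v (l r) = pt jo m (mob (jo e) (- jo b) (- jo c) (jo a) z)].
  move=> dr; have r0 := lt_trans delta0 dr.
  have [E [jo [m [z [mP hz]]]]] := gauss_point nP y r0.
  have zL := disk_notin mP r0 hz.
  exists E, jo, m, z; split=> //.
  rewrite (pt_lin_ext mP); congr lin_ext; apply: funext => f.
  by rewrite (preimage_value mP) // !(disk_lin nP mP hz) /l (max_l (ltW dr)).
exists (fun t => exists2 r, delta <= r <= 1 & t = Some (lin_ext v (l r))).
split; last split; last split.
(* At [r = delta] this is the given fixed point; beyond it, [disk_fixed] applies in the good
   coordinate. *)
- move=> _ [r /andP[dr r1] ->]; move: dr; rewrite le_eqVlt => /predU1P[<-|dr].
    by rewrite ld.
  have [E [jo [m [z [mP hz zL ->]]]]] := disk r dr.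
  apply: (pt_fixP vP d F G0 mP _).2 => [f|].
    by rewrite -!rmorphN; apply: mob_notin.
  apply: (model_fixed mP zL).1.
  exact: (disk_fixed vP nP mP hz pint qint nozero y1 yL yfix delta0 delta_le
    delta_inf dr r1).
- apply: connectedP_path => [r|h].
    have [/ld->|/disk [E [jo [m [z [mP _ _ ->]]]]]] := leP r delta.
      exact: pt_seminorm.
    exact: pt_seminorm.
  apply: lin_ext_continuous => f r; rewrite /l.
  apply: (@continuousM R R (fun r => Num.max _ (_ * Num.max r delta))
    (fun r => (Num.max _ (_ * Num.max r delta))^-1)); first exact: continuous_max_affine.
  apply: continuousV; last exact: continuous_max_affine.
  (* The denominator is positive for every [r], as [- c y + a] is nonzero for [y] outside [L]. *)
  rewrite lt0r_neq0 // lt_max (uabs_gt0 uP) lin_neq0 //.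
  exact: det_row2 det'.
- by exists delta; rewrite ?lexx ?d1 // ld.
- by exists 1; rewrite ?lexx ?d1 // l1.
Qed.

End Connect.
End Path.

(** * Counting components *)

Section FixedPoints.
Variables (R : realType) (L : closedFieldType) (v : L -> R).
Variables (d : nat) (F G : {poly L}).
Hypotheses (vP : ultra_abs v) (d2 : (2 <= d)%N) (FG : coprimep F G).
Hypothesis (sFG : maxn (size F) (size G) = d.+1).

Let sF : (size F <= d.+1)%N. Proof. by rewrite -sFG leq_maxl. Qed.
Let sG : (size G <= d.+1)%N. Proof. by rewrite -sFG leq_maxr. Qed.

Lemma den_neq0 : G != 0.
Proof.
apply/eqP => G0; move: FG sFG; rewrite G0 coprimep0 => /eqp_size.
rewrite size_poly1 size_poly0 maxn0 => -> [d0].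
by move: d2; rewrite -d0.
Qed.

(** If [F = X G], coprimality makes [G] constant and the degree is 1. *)
Lemma fixed_poly_neq0 : F - 'X * G != 0.
Proof.
apply/eqP => /subr0_eq FE; move: FG sFG.
rewrite FE coprimepMl => /andP[_]; rewrite coprimepp => sG1.
rewrite mulrC size_mulX ?den_neq0 // (eqP sG1) => -[d1].
by move: d2; rewrite -d1.
Qed.

(** [None] is the point at infinity, which is fixed exactly when the coefficient of degree [d] of
    [G] vanishes. *)
Definition classical_fixed : seq (option L) :=
  (if G`_d == 0 then [:: None] else [::]) ++
  map Some (undup (roots_of (F - 'X * G))).

Lemma size_classical_fixed : (size classical_fixed <= d.+1)%N.
Proof.
rewrite size_cat size_map; set rs := undup _.
have rP : all (root (F - 'X * G)) rs.
  apply/allP => a; rewrite mem_undup => ra; rewrite [X in root X _]roots_ofE.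
  by rewrite rootZ ?root_prod_XsubC // lead_coef_eq0 fixed_poly_neq0.
have rsz := max_poly_roots fixed_poly_neq0 rP (undup_uniq _).
have sXG : size ('X * G) = (size G).+1 by rewrite mulrC size_mulX ?den_neq0.
case: eqP => [Gd|_] /=.
  (* When infinity is fixed, [F - X G] loses its coefficient of degree [d + 1], so it has at most
     [d] roots and leaves room for [None]. *)
  rewrite add1n ltnS -ltnS; apply: (leq_trans rsz); apply/leq_sizeP => j dj.
  rewrite coefB coefXM; case: j dj => // j dj.
  rewrite (nth_default 0 (leq_trans sF dj)) sub0r /=.
  move: dj; rewrite ltnS leq_eqVlt => /predU1P[<-|dj]; first by rewrite Gd oppr0.
  by rewrite nth_default ?oppr0 // (leq_trans sG).
rewrite add0n -ltnS; apply: (leq_trans rsz).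
rewrite (leq_trans (size_polyD _ _)) // size_polyN sXG geq_max ltnS sG.
by rewrite (leq_trans sF).
Qed.

Lemma berk_fix_cases (z : berk_pt R L) : berk_fix v d F G z ->
  [\/ z = None /\ None \in classical_fixed,
      exists2 a, z = Some (evsn v a) & Some a \in classical_fixed |
      exists2 s, z = Some s & forall h, h != 0 -> s h != 0].
Proof.
case=> _; case=> [[-> zi]|[a [-> zi]]|[s [-> sn0 _]]]; last by apply: Or33; exists s.
  apply: Or31; split=> //; move: zi; rewrite /clpt; case: eqP => // Gd _.
  move: Gd; rewrite hev_1x horner_coef0 coef_poly subn0 /= => Gd.
  by rewrite /classical_fixed Gd eqxx.
apply: Or32; exists a => //; move: zi; rewrite /clpt !hev_x1 //.
case: eqP => // /eqP Ga [/(congr1 (fun s => s ('X - a%:P)))].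
rewrite /evsn !hornerE subrr (uabs0 vP) => /esym/eqP.
rewrite (uabs_eq0 vP) subr_eq0 => /eqP Fa.
rewrite /classical_fixed mem_cat; apply/orP; right.
apply: map_f; rewrite mem_undup -root_prod_XsubC.
rewrite -(rootZ _ _ (a := lead_coef (F - 'X * G))) -?roots_ofE.
  by rewrite /root !hornerE -[F.[a]](divfK Ga) Fa subrr.
by rewrite lead_coef_eq0 fixed_poly_neq0.
Qed.

Lemma nonclassical_connected (s t : {poly L} -> R) :
  complete_absval v -> potential_good_reduction v d F G ->
  berk_fix v d F G (Some s) -> (forall h, h != 0 -> s h != 0) ->
  berk_fix v d F G (Some t) -> (forall h, h != 0 -> t h != 0) ->
  same_component v (berk_fix v d F G) (Some s) (Some t).
Proof.
move=> vcomp pgr sfix sn0 tfix tn0.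
have [a [b [c [e [p [q [p' [q' [model model']]]]]]]]] :=
  good_models vP sF sG den_neq0 pgr.
suff conn u : berk_fix v d F G (Some u) -> (forall h, h != 0 -> u h != 0) ->
    same_component v (berk_fix v d F G) (Some u)
      (Some (lin_ext v (gauss_value v a b c e))).
  exact: same_component_join (conn _ sfix sn0) (conn _ tfix tn0).
move=> ufix un0.
have [K [io [n [x [nP xL uE]]]]] := norm_point vP ufix.1 un0.
have [uP _] := nP; rewrite uE in ufix *.
(* If the good coordinate of [x] lies outside the unit disk, its inverse lies inside, and the second
   model applies. *)
have [y1|y1] := leP (n (mob (io a) (io b) (io c) (io e) x)) 1.
  exact (fixed_connected_gauss vP den_neq0 vcomp model nP xL ufix y1).
rewrite gauss_valueC.
refine (fixed_connected_gauss vP den_neq0 vcomp model' nP xL ufix _).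
rewrite /mob -invf_div (uabsV _ uP) invf_le1 ?ltW //.
exact: lt_trans y1.
Qed.

End FixedPoints.

Theorem theorem3p10 (R : realType) (L : closedFieldType) (v : L -> R)
    (d : nat) (F G : {poly L}) :
  nonarch_absval v -> complete_absval v -> [pchar L] =i pred0 ->
  (2 <= d)%N -> normalized_form v d F G -> potential_good_reduction v d F G ->
  forall (n : nat) (z : 'I_n -> berk_pt R L),
    (forall i, berk_fix v d F G (z i)) ->
    (forall i j, i != j -> ~ same_component v (berk_fix v d F G) (z i) (z j)) ->
    (n <= d + 2)%N.
Proof.
move=> [v0 veq0 vM vD _] vcomp _ d2 [_ _ _ FG sFG] pgr n z zfix zsep.
have vP : ultra_abs v by split.
pose nonclassical (w : berk_pt R L) :=
  exists2 s, w = Some s & forall h, h != 0 -> s h != 0.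
(* Each fixed point gets a label: one label [None] shared by all nonclassical points, and one for
   each classical fixed point. The list [l] has at most [1 + (d + 1)] labels. *)
pose codes (k : option (option L)) (w : berk_pt R L) :=
  match k with
  | None => nonclassical w
  | Some None => w = None
  | Some (Some a) => w = Some (evsn v a)
  end.
pose l := None :: map Some (classical_fixed d F G).
have /fin_all_exists [k hk] (i : 'I_n) : exists k, k \in l /\ codes k (z i).
  case: (berk_fix_cases vP d2 FG sFG (zfix i)) => [[zi ci]|[a zi ca]|ns].
  - by exists (Some None); split=> //; rewrite inE map_f.
  - by exists (Some (Some a)); split=> //; rewrite inE map_f.
  by exists None; split=> //; rewrite inE eqxx.
(* Points with the same label are equal or both nonclassical, hence in one component, which
   separation forbids for distinct indices. *)
have kinj : injective k.
  move=> i j kij; apply/eqP/negPn/negP => ij; apply: (zsep i j ij).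
  have [_ ki] := hk i; have [_ kj] := hk j; rewrite -kij in kj.
  have same : z i = z j -> same_component v (berk_fix v d F G) (z i) (z j).
    by move=> <-; apply: same_component_refl.
  case: (k i) ki kj => [[a|]|] /=; [by move=> zi zj; apply: same; rewrite zi zj
    | by move=> zi zj; apply: same; rewrite zi zj |].
  move=> [s zi sn0] [t zj tn0]; have := zfix i; have := zfix j.
  rewrite zi zj => tfix sfix.
  exact: nonclassical_connected.
have : (size (map k (enum 'I_n)) <= size l)%N.
  apply: uniq_leq_size; first by rewrite map_inj_uniq ?enum_uniq.
  by move=> _ /mapP[i _ ->]; case: (hk i).
rewrite size_map size_enum_ord /= size_map => /leq_trans; apply.
by rewrite addn2 ltnS (size_classical_fixed d2 FG sFG).
Qed.
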